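(* Let $G$ be a finite soluble group such that every proper wide subgroup of $G$ is nilpotent. Then $G/Z_\infty(G)$ is quasi-$k$-primary, where $k=|\pi(G/Z_\infty(G))|-1$.
   Context: All groups are finite. For a group $X$, $\pi(X)$ denotes the set of all prime divisors of $|X|$. A subgroup $H$ of a group $G$ is called wide if $\pi(H)=\pi(G)$. For an integer $k$, a group $X$ is called quasi-$k$-primary if $|\pi(X)|>k$ and $|\pi(Y)|\le k$ for every maximal subgroup $Y$ of $X$ (so the trivial group, having no maximal subgroups, is quasi-$(-1)$-primary). The hypercenter of $G$ is $Z_\infty(G)=\bigcup_{i\ge 0}Z_i(G)$, where $Z_0(G)=1$ and $Z_i(G)/Z_{i-1}(G)=Z(G/Z_{i-1}(G))$ for $i\ge 1$. *)

(* Defs.v *)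
From mathcomp Require Import all_boot all_order all_algebra.
From mathcomp Require Import all_fingroup all_solvable.

Set Implicit Arguments.
Unset Strict Implicit.
Unset Printing Implicit Defensive.

Import GroupScope.

(* |pi(X)|: [primes n] is duplicate-free. *)
Definition npi (gT : finGroupType) (X : {set gT}) : nat := size (primes #|X|).

Definition wide (gT : finGroupType) (H G : {group gT}) : Prop :=
  H \subset G /\ \pi(H) =i \pi(G).

(* [k] is an integer, so that the trivial group is quasi-(-1)-primary. *)
Definition quasi_primary (gT : finGroupType) (k : int) (X : {group gT}) : Prop :=
  (k < (npi X)%:Z)%R /\
  forall Y : {group gT}, maximal Y X -> ((npi Y)%:Z <= k)%R.

(* The union of the whole upper central series; it is stationary from some
   index at most #|G| on, and [hypercenterP] shows that nothing is lost by
   bounding the index. *)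
Definition hypercenter (gT : finGroupType) (G : {set gT}) : {set gT} :=
  \bigcup_(i < #|G|.+1) 'Z_i(G).

Section Hypercenter.

Variables (gT : finGroupType) (G : {group gT}).

Lemma ucn_sub_bound n : 'Z_n(G) \subset 'Z_#|G|(G).
Proof.
have stat m k : 'Z_m.+1(G) = 'Z_m(G) -> 'Z_(k + m)(G) = 'Z_m(G).
  by move=> eqZ; elim: k => // k IHk; rewrite addSn ucnSn IHk -ucnSn.
have [m le_m_G eqZ]: exists2 m, m <= #|G| & 'Z_m.+1(G) = 'Z_m(G).
  have grow p : (exists2 m, m < p & 'Z_m.+1(G) = 'Z_m(G)) \/ p < #|'Z_p(G)|.
    elim: p => [|p [[m lt_m_p eqZ] | ltp]]; first by right; rewrite ucn0 cards1.
      by left; exists m => //; apply: ltnW.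
    have [eqZ | neqZ] := eqVneq 'Z_p.+1(G) 'Z_p(G); first by left; exists p.
    right; apply: leq_ltn_trans ltp _; apply: proper_card.
    by rewrite properEneq eq_sym neqZ ucn_subS.
  case: (grow #|G|) => [[m lt_m eqZ] | ]; first by exists m => //; apply: ltnW.
  by rewrite ltnNge subset_leq_card ?ucn_sub.
apply: subset_trans (ucn_sub_geq G le_m_G).
have [le_n_m | /ltnW le_m_n] := leqP n m; first exact: ucn_sub_geq.
by rewrite -(subnK le_m_n) stat.
Qed.

Lemma hypercenterP x :
  reflect (exists i : nat, x \in 'Z_i(G)) (x \in hypercenter G).
Proof.
apply: (iffP bigcupP) => [[i _ Zx] | [i Zx]]; first by exists i.
by exists ord_max => //; apply: subsetP Zx; apply: ucn_sub_bound.
Qed.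

Lemma hypercenter_ucn : hypercenter G = 'Z_#|G|(G).
Proof.
apply/setP=> x; apply/hypercenterP/idP=> [[i] | Zx]; last by exists #|G|.
exact/subsetP/ucn_sub_bound.
Qed.

Lemma hypercenter_normal : hypercenter G <| G.
Proof. by rewrite hypercenter_ucn ucn_normal. Qed.

Lemma hypercenter_group_set : group_set (hypercenter G).
Proof. by rewrite hypercenter_ucn groupP. Qed.

Canonical hypercenter_group := Group hypercenter_group_set.

End Hypercenter.

(* Main.v *)
(* If G/Z (Z the hypercenter) had a wide maximal subgroup, its preimage M would
   be wide and maximal in G, hence nilpotent, of index a power of some prime p.
   Let P = O_p(M). Since P is not Sylow in G, its normaliser grows outside M, so P
   is normal in G. The Hall p'-subgroup of M is a Hall p'-subgroup of G that
   centralises P, so G = C_G(P)Q with Q a Sylow p-subgroup of G containing P; thus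
   P lies in Z. Hence p does not divide |M/Z|, although it divides |G/Z|. *)
Require Import Defs.
From mathcomp Require Import all_boot all_order all_algebra.
From mathcomp Require Import all_fingroup all_solvable.

Import GroupScope.

(** Modulo the core [L] of [M], a minimal normal subgroup [N / L] of [G / L] is an elementary
    abelian p-group. Since [N] is not inside [M], maximality gives [M * N = G], and |G : M| = |N : M
    ∩ N| divides |N : L|. *)
Lemma sol_maximal_index_pnat (gT : finGroupType) (G M : {group gT}) :
  solvable G -> maximal M G -> exists2 p, prime p & p.-nat #|G : M|.
Proof.
move=> solG maxM; have [prMG maxMP] := maxgroupP maxM.
have sMG := proper_sub prMG; set L := gcore_group M G.
have nsLG : L <| G := gcore_normal sMG.
have ntGL : (G / L)%G :!=: 1.
  rewrite -subG1 quotient_sub1 ?normal_norm //.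
  by apply: contra (proper_subn prMG) => sGL; apply: subset_trans sGL (gcore_sub _ _).
have [Nb minN sNbG] := minnormal_exists ntGL (normG _).
have [_ ntN /is_abelemP[p p_pr abN]] :=
  minnormal_solvable minN sNbG (quotient_sol _ solG).
have nsNb : Nb <| G / L.
  by rewrite /normal sNbG; case/mingroupP: minN => /andP[].
have [N defN sLN nsNG] := inv_quotientN nsLG nsNb.
(* A normal subgroup of [G] inside [M] lies in the core [L], which would make [Nb] trivial. *)
have nsNM : ~~ (N \subset M).
  apply: contra ntN => sNM; rewrite defN -subG1 quotient_sub1.
    exact: gcore_max sNM (normal_norm nsNG).
  exact: subset_trans (normal_sub nsNG) (normal_norm nsLG).
have defG : M * N = G.
  rewrite -norm_joinEl ?(subset_trans sMG) ?normal_norm //; apply: contraNeq nsNM => neG.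
  have prMN: M <*> N \proper G by rewrite properEneq neG join_subG sMG normal_sub.
  by rewrite -(maxMP _ prMN (joing_subl _ _)) joing_subr.
exists p => //; rewrite -{1}defG indexMg -indexgI.
apply: (@pnat_dvd _ #|N : L|).
  by rewrite indexgS // subsetI sLN gcore_sub.
rewrite -card_quotient ?(subset_trans (normal_sub nsNG)) ?(normal_norm nsLG) //.
by rewrite -defN; apply: abelem_pgroup abN.
Qed.

(* The complement [C_G(H)] contributes nothing to commutators with [H], so the
   upper central series of [Q] already absorbs [H] inside that of [G]. *)
Lemma cent_mul_sub_hypercenter (gT : finGroupType) (G H Q : {group gT}) :
  H <| G -> nilpotent Q -> H \subset Q -> G \subset 'C(H) * Q ->
  H \subset hypercenter G.
Proof.
move=> nsHG nilQ sHQ sGCQ.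
have step n : H :&: 'Z_n(Q) \subset 'Z_n(G).
  elim: n => [|n IHn]; first by rewrite !ucn0 subsetIr.
  apply/subsetP=> x; rewrite !ucnSnR !inE => /and3P[Hx Qx sxQ].
  rewrite (subsetP (normal_sub nsHG)) //= gen_subG.
  apply/subsetP=> _ /imset2P[x' g /set1P-> Gg ->].
  have [c y Cc Qy def_g] := mulsgP (subsetP sGCQ g Gg).
  (* [x, cy] = [x, y] [x, c]^y, and [c] centralises [x]. *)
  have eq_xg : [~ x, g] = [~ x, y].
    rewrite def_g commgMJ; have /commgP/eqP-> : commute x c.
      by apply/esym; apply: (centP Cc).
    by rewrite conj1g mulg1.
  apply: (subsetP IHn); rewrite inE; apply/andP; split.
    by rewrite commgEl groupMl ?groupV // memJ_norm // (subsetP (normal_norm nsHG)).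
  by rewrite eq_xg (subsetP sxQ) // mem_commg ?set11.
have [n defQ] := ucnP _ nilQ.
apply/subsetP=> x Hx; apply/hypercenterP; exists n.
by apply: (subsetP (step n)); rewrite inE Hx defQ (subsetP sHQ).
Qed.

Lemma nil_maximal_pcore_normal (gT : finGroupType) (p : nat) (G M : {group gT}) :
  prime p -> maximal M G -> nilpotent M -> p %| #|G : M| -> 'O_p(M) <| G.
Proof.
move=> p_pr maxM nilM p_dv; have [prMG maxMP] := maxgroupP maxM.
have sMG := proper_sub prMG.
have sylP : p.-Sylow(M) 'O_p(M) := nilpotent_pcore_Hall _ nilM.
have sPG : 'O_p(M) \subset G := subset_trans (pcore_sub _ _) sMG.
have [Q sylQ sPQ] := Sylow_superset sPG (pcore_pgroup _ _).
have pQ := pHall_pgroup sylQ.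
rewrite /normal sPG; apply/negPn/negP => nnPG.
(* The normaliser contains [M] and is proper by [nnPG]. *)
have eqN : 'N_G('O_p(M)) = M.
  apply: (maxMP [group of 'N_G('O_p(M))]); last by rewrite subsetI sMG gFnorm.
  by rewrite /proper subsetIl subsetI subxx.
(* The left side is a p-subgroup of [M] containing a Sylow p-subgroup of [M]. *)
have defP : 'N_Q('O_p(M)) = 'O_p(M).
  apply: (sub_pHall sylP); first by rewrite (pgroupS _ pQ) ?subsetIl.
    by rewrite subsetI sPQ normG.
  by rewrite -{2}eqN setSI ?(pHall_sub sylQ).
(* Proper subgroups of the nilpotent group [Q] have larger normalisers. *)
have defQ : Q :=: 'O_p(M).
  by apply: (nilpotent_sub_norm (pgroup_nil pQ) sPQ); rewrite defP.
have: p^'.-nat #|G : 'O_p(M)| by rewrite -defQ; case/and3P: sylQ.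
rewrite -(Lagrange_index sMG (pcore_sub _ _)) pnatM => /andP[p'GM _].
by have := pnatPpi p'GM (p := p); rewrite !inE mem_primes p_pr p_dv indexg_gt0 eqxx => /(_ isT).
Qed.

Lemma nil_maximal_pcore_sub_hypercenter (gT : finGroupType) (p : nat)
    (G M : {group gT}) :
    prime p -> maximal M G -> nilpotent M -> p.-nat #|G : M| -> p %| #|G : M| ->
  'O_p(M) \subset hypercenter G.
Proof.
move=> p_pr maxM nilM p_GM p_dv.
have sMG := proper_sub (maxgroupp maxM).
have nsPG := nil_maximal_pcore_normal _ _ _ _ p_pr maxM nilM p_dv.
have [Q sylQ sPQ] := Sylow_superset (normal_sub nsPG) (pcore_pgroup _ _).
apply: (cent_mul_sub_hypercenter _ _ _ _ nsPG (pgroup_nil (pHall_pgroup sylQ)) sPQ).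
have sKC : 'O_p^'(M) \subset 'C_G('O_p(M)).
  rewrite subsetI (subset_trans (pcore_sub _ _) sMG).
  by have /dprodP[_ _ ->] := nilpotent_pcoreC p nilM.
(* This index divides |G : M| |M : K| with K = ['O_p^'(M)], and both factors are powers of [p]. *)
have p_GC : p.-nat #|G : 'C_G('O_p(M))|.
  apply: (@pnat_dvd _ #|G : 'O_p^'(M)|); first by rewrite indexgS.
  rewrite -(Lagrange_index sMG (pcore_sub _ _)) pnatM p_GM /=.
  have /and3P[_ _] := nilpotent_pcore_Hall p^' nilM.
  by rewrite (eq_pnat _ (negnK _)).
have p'GQ : p^'.-nat #|G : Q| by case/and3P: sylQ.
rewrite -(coprime_index_mulG _ (pHall_sub sylQ) (pnat_coprime p_GC p'GQ)) ?subsetIl //.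
by rewrite mulSg ?subsetIr.
Qed.

Theorem corollary2p1 (gT : finGroupType) (G : {group gT})
    (solG : solvable G)
    (wide_nil : forall H : {group gT}, H \proper G -> wide H G -> nilpotent H) :
  quasi_primary ((npi (G / hypercenter G)%g)%:Z - 1)%R (G / hypercenter G)%G.
Proof.
have nsZG : hypercenter_group G <| G := hypercenter_normal G.
split=> [|Y maxY]; first by rewrite Num.Theory.gtrBl.
rewrite -ltzD1 GRing.subrK ltz_nat ltnNge; apply/negP=> le_pi.
have [sYG _] := andP (maxgroupp maxY).
have [M defY sZM sMG] := inv_quotientS nsZG sYG.
have nsZM := normalS sZM sMG nsZG.
have maxM : maximal M G.
  by rewrite -(quotient_maximal nsZM nsZG) -defY.
(* An inclusion of duplicate-free lists, the smaller being at least as long, is an equality of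
   sets. *)
have eq_pi : primes #|Y| =i primes #|G / hypercenter G|.
  apply: (uniq_min_size (primes_uniq _) _ le_pi).2 => q.
  by apply: pi_of_dvd; rewrite ?cardSg.
(* [M] is wide: |G| and |M| are |Z| times |G/Z| and |Y|, which have the same primes. *)
have nilM : nilpotent M.
  apply: wide_nil; first exact: maxgroupp maxM.
  split=> // q; apply/idP/idP; first exact: piSg.
  change (q \in primes #|G| -> q \in primes #|M|).
  rewrite -(Lagrange (normal_sub nsZG)) -(Lagrange sZM) -!card_quotient ?normal_norm //.
  by rewrite !primesM ?cardG_gt0 //= -eq_pi defY.
have [p p_pr p_GM] := sol_maximal_index_pnat _ _ _ solG maxM.
(* [p.-nat] admits index 1, which properness of [M] excludes. *)
have p_dv : p %| #|G : M|.
  have [n def_n] := p_natP p_GM; rewrite def_n.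
  have: #|G : M| != 1%N by rewrite indexg_eq1 proper_subn ?(maxgroupp maxM).
  by rewrite def_n; case: n {def_n} => // n _; rewrite dvdn_exp.
have sPZ := nil_maximal_pcore_sub_hypercenter _ _ _ _ p_pr maxM nilM p_GM p_dv.
(* |Y| = |M : Z| divides |M : P|, a p'-number. *)
have p'Y : p^'.-group Y.
  rewrite /pgroup defY card_quotient ?normal_norm //.
  apply: pnat_dvd (indexgS _ sPZ) _.
  by have /and3P[] := nilpotent_pcore_Hall p nilM.
suffices: p \in primes #|Y|.
  by move=> pY; have := pnatPpi p'Y pY; rewrite !inE eqxx.
rewrite eq_pi mem_primes p_pr cardG_gt0 card_quotient ?normal_norm //.
by apply: dvdn_trans p_dv _; rewrite indexgS.
Qed.
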